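(* Let $n\ge 2$. Every infinite discrete subset $D$ of $S=SL_n(\mathbb{C})$ can be realized as the union of $n$ tame discrete subsets of $S$.
   Context: A discrete subset of a complex manifold $X$ is a subset without accumulation points in $X$. An automorphism of $X$ is a biholomorphic self-map of the complex manifold $X$ (not necessarily a group homomorphism when $X$ is a Lie group). An exhaustion function on $X$ is a continuous function $\rho:X\to\mathbb{R}^+$ (non-negative reals) all of whose sublevel sets $\{x\in X:\rho(x)\le c\}$ are compact. An infinite discrete subset $D\subset X$ is called tame if for every exhaustion function $\rho:X\to\mathbb{R}^+$ and every map $\zeta:D\to\mathbb{R}^+$ there exists an automorphism $\phi$ of $X$ such that $\rho(\phi(x))\ge\zeta(x)$ for all $x\in D$. The sets in the union are not required to be disjoint or distinct. *)

(* Defs.v *)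
From HB Require Import structures.
From mathcomp Require Import all_boot all_order all_algebra.
From mathcomp Require Import complex.
From mathcomp Require Import all_classical all_reals all_analysis.

Set Implicit Arguments.
Unset Strict Implicit.
Unset Printing Implicit Defensive.

Import Order.TTheory GRing.Theory Num.Theory.
Import numFieldNormedType.Exports.

Local Open Scope classical_set_scope.
Local Open Scope ring_scope.
Local Open Scope complex_scope.

(* The norm topology on C, as on any numFieldType. *)
HB.instance Definition _ (R : rcfType) := NormedModule.copy R[i] R[i]^o.

(* A complex manifold is represented by a subset X of a complex normed space V,
   meant to be an embedded complex submanifold of a finite-dimensional V. Maps
   defined on X are represented by functions on V whose values outside X are
   irrelevant: none of the notions below depends on them. *)

(* Holomorphy for the structure induced on X by V: around each point of X, f is
   the restriction of a map that is complex differentiable on an open subset of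
   V. Here [differentiable] is C-linear, since V and W are normed R[i]-modules. *)
Definition holomorphic_on (R : realType) (V W : normedModType R[i])
    (X : set V) (f : V -> W) : Prop :=
  forall x, X x -> exists g : V -> W,
    (\forall y \near x, differentiable g y) /\
    (\forall y \near x, X y -> f y = g y).

Definition automorphism (R : realType) (V : normedModType R[i])
    (X : set V) (phi : V -> V) : Prop :=
  set_fun X X phi /\ holomorphic_on X phi /\
  exists psi : V -> V,
    [/\ set_fun X X psi, holomorphic_on X psi,
        forall x, X x -> psi (phi x) = x &
        forall x, X x -> phi (psi x) = x].

Definition discrete_subset (T : topologicalType) (X D : set T) : Prop :=
  D `<=` X /\ forall x, X x -> ~ limit_point D x.

Definition exhaustion (R : realType) (T : topologicalType)
    (X : set T) (rho : T -> R) : Prop :=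
  [/\ forall x, X x -> 0 <= rho x,
      {within X, continuous rho} &
      forall c : R, compact [set x | X x /\ rho x <= c]].

Definition tame (R : realType) (V : normedModType R[i]) (X D : set V) : Prop :=
  [/\ infinite_set D,
      discrete_subset X D &
      forall (rho : V -> R) (zeta : V -> R),
        exhaustion X rho ->
        (forall x, D x -> 0 <= zeta x) ->
        exists phi : V -> V,
          automorphism X phi /\ forall x, D x -> zeta x <= rho (phi x)].

Definition SL (R : realType) (n : nat) : set 'M[R[i]]_n :=
  [set A | \det A = 1].
Arguments SL : clear implicits.

(* Main.v *)
Require Import Defs.
From mathcomp Require Import all_boot all_order all_algebra.
From mathcomp Require Import perm complex.
From mathcomp Require Import all_classical all_reals all_analysis.
From mathcomp Require Import ring lra.
Import numFieldNormedType.Exports.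
Local Open Scope classical_set_scope.

Import Order.TTheory GRing.Theory Num.Theory.
Import ComplexField.Normc.
Local Open Scope ring_scope.
Local Open Scope complex_scope.
Set Implicit Arguments.
Unset Strict Implicit.
Unset Printing Implicit Defensive.

(** Split [D] according to the column that contains an entry of largest modulus.
    Bounded closed subsets of SL_n(C) are compact, so only finitely many
    matrices of [D] have all entries below a given bound
    ([discrete_SL_finite]); hence on the piece attached to column [j] the map
    taking a matrix to its [j]-th column is proper ([column_proper]). A piece
    may be finite, and then it is enlarged by a fixed infinite piece [E j0]:
    finitely many extra points do not spoil properness of column [j0].

    It remains to see that a set on which some column [j1] is proper is tame
    ([tame_of_column_proper]). Adding to column [j2] the multiple
    [f (column j1)] of column [j1] is an automorphism of SL_n(C) for every
    entire function [f], as it does not change column [j1] and is undone by the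
    same operation with [- f]. Since the sublevel sets of an exhaustion are
    bounded, tameness follows once [f] can be made as large as one wishes at the
    columns [v 0, v 1, ...] of the points of the set, a sequence of nonzero
    vectors tending to infinity.

    Such an [f] is a series of monomials [c k * (z_i / a k) ^+ N k], where [a k]
    is a coordinate of [v k] of largest modulus and [i] its position
    ([entire_growth]). The monomial equals [c k] at [v k], and on the polydisc
    of radius [normc (a k) / 2] it is at most [c k * 2^-1 ^+ N k], which is
    summable when [N k] is large enough; these polydiscs exhaust the space. At
    each earlier point [v j] the ratio [v j i / a k] either has modulus less
    than [1], and a large [N k] makes the monomial negligible, or has modulus at
    least [1], and then the monomial is at least [c k] in modulus for every
    [N k], so that a large [c k] makes the partial sum large again. Therefore the points can be treated in any order. *)

(** * The modulus as a real number *)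

Section Modulus.
Variable R : realType.
Implicit Types x y z : R[i].

(** The norm of [R[i]] takes values in [R[i]], which is only partially ordered;
    [normc] moves every estimate to the real field [R]. *)
Lemma normr_normc z : `|z| = (normc z)%:C.
Proof. by case: z. Qed.

Lemma normc_ge0 z : 0 <= normc z.
Proof. by rewrite -lecR -normr_normc normr_ge0. Qed.

Lemma normc_real (c : R) : 0 <= c -> normc c%:C = c.
Proof. by move=> c0; rewrite /normc /= expr0n/= addr0 sqrtr_sqr ger0_norm. Qed.

Lemma normc_nat n : normc (n%:R : R[i]) = n%:R.
Proof. by rewrite -(rmorph_nat (real_complex R)) normc_real. Qed.

Lemma normcX z n : normc (z ^+ n) = normc z ^+ n.
Proof. by elim: n => [|n IH]; rewrite ?expr0 ?normc1// !exprS normcM IH. Qed.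

Lemma normcD_le x y : normc (x + y) <= normc x + normc y.
Proof. exact: le_normcD. Qed.

Lemma normcB x y : normc (x - y) = normc (y - x).
Proof. by rewrite -opprB; exact: normcN. Qed.

Lemma normc_gt0 z : z != 0 -> 0 < normc z.
Proof.
move=> z0; rewrite lt_neqAle normc_ge0 andbT eq_sym.
by apply: contra z0 => /eqP/eq0_normc ->.
Qed.

Lemma normcD_ge x y : normc x - normc y <= normc (x + y).
Proof.
have := normcD_le (x + y) (- y).
rewrite addrK (_ : normc (- y) = normc y); first by lra.
exact: normcN.
Qed.

Lemma normc_sum (I : Type) (r : seq I) (P : pred I) (F : I -> R[i]) :
  normc (\sum_(i <- r | P i) F i) <= \sum_(i <- r | P i) normc (F i).
Proof.
elim/big_ind2 : _ => [|x a y b xa yb|//]; first by rewrite normc0.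
exact: le_trans (normcD_le _ _) (lerD xa yb).
Qed.

Lemma Re_le_normc z : `|complex.Re z| <= normc z.
Proof.
case: z => a b /=; rewrite -sqrtr_sqr ler_sqrt ?addr_ge0 ?sqr_ge0//.
by rewrite lerDl sqr_ge0.
Qed.

Lemma Im_le_normc z : `|complex.Im z| <= normc z.
Proof.
case: z => a b /=; rewrite -sqrtr_sqr ler_sqrt ?addr_ge0 ?sqr_ge0//.
by rewrite lerDr sqr_ge0.
Qed.

Lemma normc_le_ReIm z : normc z <= `|complex.Re z| + `|complex.Im z|.
Proof.
case: z => a b /=; rewrite -[leRHS]ger0_norm ?addr_ge0 ?normr_ge0//.
rewrite -sqrtr_sqr ler_sqrt ?sqr_ge0// sqrrD !real_normK ?num_real//.
by rewrite addrAC lerDl mulrn_wge0// mulr_ge0.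
Qed.

Lemma pos_complexP z : 0 < z -> exists2 r : R, 0 < r & z = r%:C.
Proof.
move=> z0; have /complex_realP[r zr] : z \is Num.real by exact: gtr0_real.
by exists r => //; rewrite -ltcR -zr.
Qed.

End Modulus.

(** * Series of complex numbers and entire functions *)

Section Series.
Variable R : realType.
Implicit Types x y z h : R[i].

Lemma cvg_geometric_dominated (b : nat -> R) (K : nat) :
  (forall k, 0 <= b k) -> (forall k, (K <= k)%N -> b k <= 2^-1 ^+ k) ->
  cvgn (series b).
Proof.
move=> b0 bK.
(* The sum makes [M / 2 ^ k] dominate also the terms with [k < K]. *)
pose M := 1 + \sum_(k < K) b k * 2 ^+ k.
have s0 : 0 <= \sum_(k < K) b k * 2 ^+ k.
  by apply: sumr_ge0 => k _; rewrite mulr_ge0 ?exprn_ge0.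
apply: (@series_le_cvg _ b (geometric M 2^-1)) => //.
- by move=> k /=; rewrite mulr_ge0 ?exprn_ge0// addr_ge0.
- move=> k /=; have [Kk|kK] := leqP K k.
    apply: le_trans (bK _ Kk) _; rewrite ler_peMl ?exprn_ge0// /M.
    by rewrite lerDl.
  rewrite exprVn ler_pdivlMr ?exprn_gt0// /M (bigD1 (Ordinal kK))//=.
  rewrite addrCA lerDl addr_ge0// sumr_ge0// => i _.
  by rewrite mulr_ge0 ?exprn_ge0.
- by apply: is_cvg_geometric_series; rewrite ger0_norm//; lra.
Qed.

(** Completeness of [R] is used on the real and on the imaginary parts. *)
Lemma complex_series_cvg (u : nat -> R[i]) (b : nat -> R) :
  (forall k, normc (u k) <= b k) -> cvgn (series b) ->
  exists l, forall e : R, 0 < e ->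
    \forall m \near \oo, normc (l - \sum_(k < m) u k) <= e.
Proof.
move=> ub cb.
have part (p : {additive R[i] -> R}) : (forall z, `|p z| <= normc z) ->
    exists l : R, forall e : R, 0 < e ->
    \forall m \near \oo, `|l - p (\sum_(k < m) u k)| <= e.
  move=> pn; have cn : cvgn [normed series (p \o u)].
    apply: (@series_le_cvg _ _ b) => //.
    - by move=> k /=; rewrite normr_ge0.
    - by move=> k; exact: le_trans (normc_ge0 _) (ub k).
    - by move=> k /=; exact: le_trans (pn _) (ub k).
  have := normed_cvg cn => /cvg_ex[l ul]; exists l => e e0.
  move/cvgrPdist_le : ul => /(_ e e0); apply: filterS => m.
  rewrite (_ : series (p \o u) m = p (\sum_(k < m) u k))//.
  by rewrite raddf_sum /series /= big_mkord.
have [a Ha] := part (@complex.Re R : Rcomplex R -> R) (@Re_le_normc R).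
have [b' Hb] := part (@complex.Im R : Rcomplex R -> R) (@Im_le_normc R).
exists (a +i* b') => e e0.
have e2 : 0 < e / 2 by lra.
apply: filterS2 (Ha _ e2) (Hb _ e2) => m Hre Him.
apply: le_trans (normc_le_ReIm _) _.
move: Hre Him; case: (\sum_(k < m) u k) => x y /= Hre Him; lra.
Qed.

(** In the binomial expansion of the left-hand side every term has a factor
    [y ^+ 2], and [normc y ^+ i <= d ^+ 2 * B ^+ i] for [2 <= i] because
    [d <= 1]; what remains is the same expansion for [normc x] and [B]. The
    right-hand side is written in closed form to make the induction on [n]
    exact. *)
Lemma power_remainder x y (B d : R) n : 0 <= B -> 0 <= d <= 1 ->
  normc y <= B * d ->
  normc ((x + y) ^+ n - x ^+ n - n%:R * x ^+ n.-1 * y) <=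
    d ^+ 2 * ((normc x + B) ^+ n - normc x ^+ n - n%:R * normc x ^+ n.-1 * B).
Proof.
move=> B0 /andP[d0 d1] yB.
elim: n => [|n IH].
  by rewrite !expr0 subrr !mul0r subr0 normc0 subrr subr0 mulr0.
set E := _ - _ - _ in IH; set F := _ - _ - _ in IH.
have -> : (x + y) ^+ n.+1 - x ^+ n.+1 - n.+1%:R * x ^+ n.+1.-1 * y =
   (x + y) * E + n%:R * x ^+ n.-1 * y ^+ 2.
  rewrite /E; case: (n) => [|m]; rewrite ?expr0 ?expr1 /=; first by ring.
  by rewrite !exprS -!natr1; ring.
have -> : (normc x + B) ^+ n.+1 - normc x ^+ n.+1
     - n.+1%:R * normc x ^+ n.+1.-1 * B =
   (normc x + B) * F + n%:R * normc x ^+ n.-1 * B ^+ 2.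
  rewrite /F; case: (n) => [|m]; rewrite ?expr0 ?expr1 /=; first by ring.
  by rewrite !exprS -!natr1; ring.
have F0 : 0 <= d ^+ 2 * F by exact: le_trans (normc_ge0 _) IH.
apply: le_trans (normcD_le _ _) _; rewrite [leRHS]mulrDr lerD//.
  rewrite normcM mulrCA; apply: ler_pM; rewrite ?normc_ge0//.
  apply: le_trans (normcD_le _ _) _; rewrite lerD2l (le_trans yB)//.
  by rewrite ler_piMr.
rewrite !normcM !normcX normc_nat -expr2 [leRHS]mulrCA.
rewrite ler_wpM2l ?mulr_ge0 ?exprn_ge0 ?normc_ge0//.
by rewrite mulrC -exprMn lerXn2r// ?nnegrE ?normc_ge0 ?mulr_ge0.
Qed.

End Series.

Section Entire.
Variable R : realType.
Implicit Types z h : R[i].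

(** Divided by [h], the remainder is at most [normc h * B]. *)
Lemma derivable_remainder (f : R[i] -> R[i]) z (a : R[i]) (B : R) :
  (forall h, normc h <= 1 ->
     normc (f (z + h) - f z - a * h) <= normc h ^+ 2 * B) ->
  derivable f z 1.
Proof.
move=> fB; apply/cvg_ex; exists a.
apply/cvgrPdist_le => /= _ /pos_complexP[r r0 ->].
have B1 : 0 < `|B| + 1 by rewrite ltr_wpDl.
pose d := Num.min 1 (r / (`|B| + 1)).
have d0 : 0 < d%:C :> R[i] by rewrite ltcR lt_min ltr01 divr_gt0.
near=> h.
have h0 : h != 0 by near: h; exact: nbhs_dnbhs_neq.
have hd : normc h <= d.
  by rewrite -lecR -normr_normc; near: h; exact: dnbhs0_le.
move: hd; rewrite le_min => /andP[h1 hr].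
have nh := normc_gt0 h0.
have := fB _ h1; rewrite normr_normc lecR => fh.
rewrite (_ : _ - _ = - (h^-1 * (f (z + h) - f z - a * h))); last first.
  by rewrite [h%:A]mulr1 [h + z]addrC /GRing.scale/=; field.
rewrite [normc _]normcN normcM normcV mulrC ler_pdivrMr//.
apply: le_trans fh _; rewrite expr2 mulrC mulrA ler_pM2r//.
move: hr; rewrite ler_pdivlMr// => hr; apply: le_trans hr.
have := normc_ge0 h; have := ler_norm B; nra.
Unshelve. all: by end_near. Qed.

(** Differentiation under the sum: by [power_remainder] with [B = 1], the second
    order remainders of all partial sums at [z] are bounded by one multiple of
    [normc h ^+ 2], namely by the value of the majorant series at
    [normc z + 1], and this bound passes to the limit. *)
Lemma entire_series (al : nat -> R[i]) (N : nat -> nat) :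
  (forall r : R, 0 <= r -> cvgn (series (fun k => normc (al k) * r ^+ N k))) ->
  exists g : R[i] -> R[i], (forall z, derivable g z 1) /\
    forall z (e : R), 0 < e ->
      \forall m \near \oo, normc (g z - \sum_(k < m) al k * z ^+ N k) <= e.
Proof.
move=> cal.
have /choice[g gP] : forall z, exists l, forall e : R, 0 < e ->
    \forall m \near \oo, normc (l - \sum_(k < m) al k * z ^+ N k) <= e.
  move=> z.
  have uz k : normc (al k * z ^+ N k) <= normc (al k) * normc z ^+ N k.
    by rewrite normcM normcX.
  exact: complex_series_cvg uz (cal _ (normc_ge0 z)).
exists g; split=> // z.
pose b k := normc (al k) * (normc z + 1) ^+ N k.
have cb : cvgn (series b) by apply: cal; rewrite addr_ge0 ?normc_ge0.
have b0 k : 0 <= b k by rewrite mulr_ge0 ?exprn_ge0 ?addr_ge0 ?normc_ge0.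
have dpow k : normc ((N k)%:R * z ^+ (N k).-1) <= (normc z + 1) ^+ N k.
  (* For [x = normc z] and [y = B = d = 1] the bound is nonnegative, which is
     Bernoulli's inequality. *)
  have := @power_remainder R (normc z)%:C 1 1 1 (N k) ler01.
  rewrite lexx ler01 normc1 mulr1 => /(_ isT (lexx _)).
  move/(le_trans (normc_ge0 _)).
  rewrite expr1n mul1r mulr1 normc_real ?normc_ge0//.
  rewrite normcM normcX normc_nat.
  have : 0 <= normc z ^+ N k by rewrite exprn_ge0 ?normc_ge0.
  lra.
have [a aP] : exists l, forall e : R, 0 < e -> \forall m \near \oo,
    normc (l - \sum_(k < m) al k * ((N k)%:R * z ^+ (N k).-1)) <= e.
  have du k : normc (al k * ((N k)%:R * z ^+ (N k).-1)) <= b k.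
    by rewrite normcM ler_wpM2l ?normc_ge0.
  exact: complex_series_cvg du cb.
(* It suffices to bound the remainder of [g] up to an arbitrary [e], and [g] is
   compared with a partial sum at [z], at [z + h] and for the derivative. *)
apply: (@derivable_remainder g z a (limn (series b))) => h h1.
apply/ler_addgt0Pr => e e0.
have e3 : 0 < e / 3 by lra.
near \oo => m.
have g1 : normc (g z - \sum_(k < m) al k * z ^+ N k) <= e / 3.
  by near: m; exact: gP.
have g2 : normc (g (z + h) - \sum_(k < m) al k * (z + h) ^+ N k) <= e / 3.
  by near: m; exact: gP.
have g3 : normc (a - \sum_(k < m) al k * ((N k)%:R * z ^+ (N k).-1)) <= e / 3.
  by near: m; exact: aP.
set S1 := \sum_(k < m) _ in g1; set S2 := \sum_(k < m) _ in g2.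
set S3 := \sum_(k < m) _ in g3.
have SB : normc (S2 - S1 - S3 * h) <= normc h ^+ 2 * limn (series b).
  rewrite /S1 /S2 /S3 mulr_suml -!sumrB.
  apply: le_trans (normc_sum _ _ _) _.
  apply: (@le_trans _ _ (normc h ^+ 2 * series b m)).
    rewrite /series /= big_mkord mulr_sumr ler_sum// => k _.
    rewrite -mulrA -!mulrBr normcM [leRHS]mulrCA ler_wpM2l ?normc_ge0//.
    apply: le_trans (@power_remainder R z h 1 (normc h) (N k) _ _ _) _ => //.
    - by rewrite normc_ge0.
    - by rewrite mul1r.
    rewrite ler_wpM2l ?exprn_ge0 ?normc_ge0// mulr1.
    have : 0 <= normc z ^+ N k by rewrite exprn_ge0 ?normc_ge0.
    have : 0 <= (N k)%:R * normc z ^+ (N k).-1.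
      by rewrite mulr_ge0// exprn_ge0 ?normc_ge0.
    lra.
  rewrite ler_wpM2l ?exprn_ge0 ?normc_ge0//.
  by apply: nondecreasing_cvgn_le => //; exact: nondecreasing_series.
have g3h : normc ((a - S3) * h) <= e / 3.
  rewrite normcM; apply: le_trans g3; rewrite ler_piMr ?normc_ge0//.
rewrite (_ : _ - _ - _ = (S2 - S1 - S3 * h) +
   ((g (z + h) - S2) + (S1 - g z) + (S3 - a) * h)); last by ring.
apply: le_trans (normcD_le _ _) _; apply: lerD => //.
apply: le_trans (normcD_le _ _) _.
apply: le_trans (lerD (normcD_le _ _) (lexx _)) _.
rewrite [normc (S1 - _)]normcB [normc ((S3 - a) * h)]normcM.
rewrite [normc (S3 - _)]normcB.
rewrite -normcM; lra.
Unshelve. all: by end_near. Qed.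

End Entire.

(** * An entire function with prescribed growth along a sequence *)

Section Growth.
Variables (R : realType) (I : finType).

Lemma small_power (c q e : R) : 0 <= q < 1 -> 0 < e ->
  \forall N \near \oo, c * q ^+ N <= e.
Proof.
move=> /andP[q0 q1] e0.
have /cvgrPdist_le/(_ e e0) : geometric c q @ \oo --> (0 : R).
  by apply: cvg_geometric; rewrite ger0_norm.
by apply: filterS => N; rewrite /= sub0r normrN => /(le_trans (ler_norm _)).
Qed.

Variables (v : nat -> I -> R[i]) (idx : nat -> I) (M : nat -> R).
Let a k := v k (idx k).
Let ratio k j := v j (idx k) / a k.
Hypothesis a0 : forall k, a k != 0.
Hypothesis a_infty : forall r : R, \forall k \near \oo, r <= normc (a k).

(** One step of the construction: [s] lists the values at the points [v j] of
    the partial sum built so far, and [p] is the pair of the coefficient [c k]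
    and the exponent [N k]. The second alternative is the only one offered for
    [j = k], since [ratio k k = 1]. *)
Lemma growth_step (k : nat) (s : nat -> R[i]) : exists p : R * nat,
  [/\ 0 <= p.1, p.1 * 2^-1 ^+ p.2 <= 2^-1 ^+ k &
    forall j, (j <= k)%N ->
      ((j < k)%N /\ normc (p.1%:C * ratio k j ^+ p.2) <= 2^-1 ^+ k) \/
      M j + 2 <= normc (s j + p.1%:C * ratio k j ^+ p.2)].
Proof.
(* A common upper bound for the numbers [M j + 2 + normc (s j)]. *)
pose c : R := \sum_(j < k.+1) (`|M j| + 2 + normc (s j)).
have pos j : 0 <= `|M j| + 2 + normc (s j).
  by rewrite !addr_ge0// normc_ge0.
have c0 : 0 <= c by apply: sumr_ge0.
have e0 : 0 < (2^-1 : R) ^+ k by rewrite exprn_gt0.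
have [N [N1 N2]] : exists N, c * 2^-1 ^+ N <= 2^-1 ^+ k /\
    forall j : 'I_k.+1, normc (ratio k j) < 1 ->
      c * normc (ratio k j) ^+ N <= 2^-1 ^+ k.
  near \oo => N; exists N; split.
    by near: N; apply: small_power => //; lra.
  near: N; apply: filter_forall => j.
  have [r1|r1] := ltP (normc (ratio k j)) 1; last by near=> N.
  by near=> N => _; near: N; apply: small_power; rewrite ?normc_ge0.
exists (c, N); split => // j jk /=.
have jk1 : (j < k.+1)%N by [].
have [r1|r1] := ltP (normc (ratio k j)) 1; [left|right].
  split; last by rewrite normcM normcX normc_real// (N2 (Ordinal jk1)).
  rewrite ltn_neqAle jk andbT; apply/eqP => jk'; move: r1.
  by rewrite jk' /ratio (divff (a0 k)) normc1 ltxx.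
rewrite [s j + _]addrC; apply: le_trans (normcD_ge _ _).
rewrite normcM normcX normc_real//.
have : c <= c * normc (ratio k j) ^+ N by rewrite ler_peMr// exprn_ege1.
have : `|M j| + 2 + normc (s j) <= c.
  by rewrite /c (bigD1 (Ordinal jk1))//= lerDl sumr_ge0.
have := ler_norm (M j); lra.
Unshelve. all: by end_near. Qed.

(** A sum of one-variable entire functions suffices, since every monomial of the
    construction involves one coordinate. Once [v j] has been treated, the
    partial sums stay at least [M j + 2 * 2^-1 ^+ k] in modulus at [v j]: a
    negligible term costs [2^-1 ^+ k] and any other one restores [M j + 2]. *)
Lemma entire_growth : exists g : I -> R[i] -> R[i],
  (forall i z, derivable (g i) z 1) /\
  forall j, M j <= normc (\sum_i g i (v j i)).
Proof.
have /choice[f fP] : forall ks : nat * (nat -> R[i]), exists p : R * nat, _ :=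
  fun ks => growth_step ks.1 ks.2.
pose next (kS : nat * (nat -> R[i])) := (kS.1.+1, fun j =>
  kS.2 j + (f kS).1%:C * ratio kS.1 j ^+ (f kS).2).
pose st k := iter k next (0, fun=> 0).
have st1 k : (st k).1 = k by elim: k => //= k ->.
pose S k := (st k).2.
pose c k := (f (st k)).1.
pose N k := (f (st k)).2.
have SS k j : S k.+1 j = S k j + (c k)%:C * ratio k j ^+ N k.
  by rewrite /S /= st1.
have SE k j : S k j = \sum_(l < k) (c l)%:C * ratio l j ^+ N l.
  by elim: k => [|k IH]; rewrite ?big_ord0// big_ord_recr -IH SS.
have c0 k : 0 <= c k by have [] := fP (st k).
have cN k : c k * 2^-1 ^+ N k <= 2^-1 ^+ k.
  by have [_ + _] := fP (st k); rewrite st1.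
have inv k j : (j < k)%N -> M j + 2 * 2^-1 ^+ k <= normc (S k j).
  elim: k j => // k IH j; rewrite ltnS => jk.
  have [_ _ /(_ j)] := fP (st k); rewrite st1 => /(_ jk).
  rewrite -/(c k) -/(N k) -/(S k) SS.
  have e1 : (2^-1 : R) ^+ k.+1 = 2^-1 ^+ k / 2 by rewrite exprSr.
  case=> [[jk' small]|big].
    apply: le_trans (normcD_ge _ _); rewrite e1.
    have := IH j jk'; lra.
  apply: le_trans big; rewrite lerD2l e1.
  have : (2^-1 : R) ^+ k <= 1 by rewrite exprn_ile1//; lra.
  lra.
pose al i k := if idx k == i then (c k)%:C / a k ^+ N k else 0.
have na k : 0 < normc (a k) by exact: normc_gt0.
have cal i (r : R) : 0 <= r ->
    cvgn (series (fun k => normc (al i k) * r ^+ N k)).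
  move=> r0.
  (* For [K <= k] one has [r / normc (a k) <= 2^-1], and the choice of [N k]
     applies. *)
  have [K _ KP] := a_infty (2 * r).
  apply: (@cvg_geometric_dominated R _ K) => k.
    by rewrite mulr_ge0 ?normc_ge0 ?exprn_ge0.
  move=> Kk; rewrite /al; case: eqP => _; last by rewrite normc0 mul0r exprn_ge0.
  apply: le_trans (cN k).
  rewrite normcM normcV normcX normc_real// -mulrA ler_wpM2l//.
  rewrite -exprVn -exprMn lerXn2r ?nnegrE ?mulr_ge0 ?invr_ge0 ?normc_ge0//.
  rewrite mulrC ler_pdivrMr//; have := KP k Kk; rewrite /= => ?; lra.
have /choice[g gP] := fun i => entire_series (cal i).
exists g; split=> [i z|j]; first exact: (gP i).1.
apply/ler_addgt0Pr => e e0.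
have e'0 : 0 < e / #|I|.+1%:R by rewrite divr_gt0.
near \oo => m.
have mj : (j < m)%N by near: m; exact: nbhs_infty_gt.
have gm i : normc (g i (v j i) - \sum_(k < m) al i k * v j i ^+ N k)
    <= e / #|I|.+1%:R.
  move: i; near: m; apply: filter_forall => i; exact: (gP i).2.
have := inv m j mj.
have -> : S m j = \sum_i \sum_(k < m) al i k * v j i ^+ N k.
  rewrite SE exchange_big /=; apply: eq_bigr => k _.
  rewrite (bigD1 (idx k))//= big1 ?addr0 => [|i /negbTE ik].
    by rewrite /al eqxx /ratio exprMn exprVn mulrA mulrAC.
  by rewrite /al eq_sym ik mul0r.
have : normc (\sum_i g i (v j i) -
    \sum_i \sum_(k < m) al i k * v j i ^+ N k) <= e.
  rewrite -sumrB; apply: le_trans (normc_sum _ _ _) _.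
  apply: (@le_trans _ _ (\sum_(i : I) e / #|I|.+1%:R)); first exact: ler_sum.
  rewrite sumr_const -[_ *+ #|_|]mulr_natr -mulrA ler_piMr ?(ltW e0)//.
  by rewrite ler_pdivrMl// mulr1 ler_nat.
set T := \sum_i \sum_(k < m) _; set G := \sum_i _ => GT.
have : normc T <= normc G + normc (G - T).
  by rewrite normcB -[leLHS](congr1 (@normc R) (subrK G T)) addrC normcD_le.
have : 0 <= (2^-1 : R) ^+ m by rewrite exprn_ge0.
lra.
Unshelve. all: by end_near. Qed.

End Growth.

(** * Compactness in spaces of complex matrices *)

Section Compactness.
Variable R : realType.

Lemma normc_continuous : continuous (@normc R : R[i] -> R).
Proof.
move=> z U /nbhs_ballP[e /= e0 eU]; apply/nbhs_ballP.
exists e%:C => [|w] /=; first by rewrite ltcR.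
rewrite -ball_normE /= normr_normc ltcR => zw; apply: eU; rewrite -ball_normE /=.
apply: le_lt_trans zw.
have := normcD_le (z - w) w; have := normcD_le (w - z) z.
rewrite !subrK [normc (w - z)]normcB ler_norml => ? ?; lra.
Qed.

Lemma mk_complex_continuous : continuous (fun p : R * R => p.1 +i* p.2).
Proof.
move=> p U /nbhs_ballP[_ /= /pos_complexP[e e0 ->] eU].
have e2 : 0 < e / 2 by lra.
exists (ball p.1 (e / 2), ball p.2 (e / 2)).
  by split; exact: nbhsx_ballx.
move=> q []; rewrite -!ball_normE /= => q1 q2; apply: eU.
rewrite -ball_normE /= normr_normc ltcR.
apply: le_lt_trans (normc_le_ReIm _) _ => /=; lra.
Qed.

Lemma complex_square_compact (r : R) :
  compact [set z : R[i] | `|complex.Re z| <= r /\ `|complex.Im z| <= r].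
Proof.
rewrite (_ : mkset _ =
  (fun p : R * R => p.1 +i* p.2) @` (`[- r, r] `*` `[- r, r])).
  apply: continuous_compact.
    by apply: continuous_subspaceT; exact: mk_complex_continuous.
  by apply: compact_setX; exact: segment_compact.
rewrite predeqE => -[x y] /=; split=> [[xr yr]|[[x' y'] /= [xr yr] [<- <-]]].
  by exists (x, y); rewrite //= !in_itv /= -!ler_norml.
by move: xr yr; rewrite !in_itv /= -!ler_norml.
Qed.

(** Heine-Borel for complex matrices, by Tychonoff from the compactness of
    squares in the complex plane. *)
Lemma mx_bounded_compact (m n : nat) (r : R) :
  exists2 K : set 'M[R[i]]_(m, n), compact K &
    [set A : 'M[R[i]]_(m, n) | forall p q, normc (A p q) <= r] `<=` K.
Proof.
pose B := [set v : 'rV[R[i]]_(m * n) | forall i, [set z : R[i] |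
  `|complex.Re z| <= r /\ `|complex.Im z| <= r] (v ord0 i)].
exists (@vec_mx R[i] m n @` B).
  apply: continuous_compact; last first.
    apply: (@rV_compact R[i] (m * n) (fun=> _)) => i.
    exact: complex_square_compact.
  apply: continuous_subspaceT => v A [E vE EA].
  (* A neighbourhood of a matrix is given by neighbourhoods of its entries; [F]
     reindexes those by the coordinates of a row vector. *)
  pose F := (fun i j => E (enum_val (cast_ord (esym (mxvec_cast m n)) j)).1
     (enum_val (cast_ord (esym (mxvec_cast m n)) j)).2)
     : 'I_1 -> 'I_(m * n) -> set R[i].
  exists F.
    move=> i j; rewrite /F; move: (vE) => /(_ _ _); set x := enum_val _.
    move=> /(_ x.1 x.2); rewrite mxE (ord1 i).
    rewrite (_ : mxvec_index x.1 x.2 = j)//.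
    by rewrite /mxvec_index -surjective_pairing /x enum_valK cast_ordKV.
  move=> w wF; apply: EA => i j; rewrite mxE.
  have := wF ord0 (mxvec_index i j); rewrite /F.
  by rewrite /mxvec_index cast_ordK enum_rankK.
move=> A Ar; exists (mxvec A); last exact: mxvecK.
move=> l /=; rewrite -[l](cast_ordKV (mxvec_cast m n)).
set x := cast_ord _ l; rewrite -[x]enum_valK; case: (enum_val x) => p q.
rewrite (_ : cast_ord _ _ = mxvec_index p q)// mxvecE.
by split; [apply: le_trans (Re_le_normc _) _|apply: le_trans (Im_le_normc _) _].
Qed.

(** A cluster point of the filter of sets that contain all but finitely many
    points of [D] is a limit point: removing one point from [D] does not leave
    the filter. *)
Lemma infinite_compact_limit_point (T : topologicalType) (D K : set T) :
  compact K -> infinite_set D -> D `<=` K ->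
  exists2 x, K x & limit_point D x.
Proof.
move=> cK iD DK.
pose F := [set B : set T | finite_set (D `\` B)].
have FF : ProperFilter F.
  split; last first.
    split; rewrite /F /=.
    - by rewrite setDT.
    - by move=> P Q fP fQ; rewrite /= setDIr finite_setU.
    - by move=> P Q PQ; apply: sub_finite_set => x [Dx nQ]; split=> // /PQ.
  by rewrite /F /= setD0.
have FK : F K by move: DK; rewrite /F /= -setD_eq0 => ->.
have [x [Kx cl]] := cK F FF FK.
exists x => // U Ux.
have FDx : F (D `\ x).
  apply: (@sub_finite_set _ _ [set x]) => // y [Dy nDy] /=.
  by apply: contrapT => yx; apply: nDy.
by have [y [[Dy /eqP yx] Uy]] := cl _ _ FDx Ux; exists y.
Qed.

Lemma compact_mx_bounded (m n : nat) (K : set 'M[R[i]]_(m, n)) : compact K ->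
  exists r : R, forall A, K A -> forall p q, normc (A p q) <= r.
Proof.
move=> cK.
have each (pq : 'I_m * 'I_n) : exists r : R,
    forall A, K A -> normc (A pq.1 pq.2) <= r.
  have : compact ((fun A : 'M[R[i]]_(m, n) => normc (A pq.1 pq.2)) @` K).
    apply: continuous_compact => //; apply: continuous_subspaceT => A.
    apply: (@continuous_comp _ _ _ (fun A : 'M[R[i]]_(m, n) => A pq.1 pq.2)
      (@normc R)); [exact: coord_continuous|exact: normc_continuous].
  move=> /compact_bounded[M [_ MP]]; exists (M + 1) => A KA.
  apply: le_trans (ler_norm _) _; apply: (MP (M + 1)); first by rewrite ltrDl.
  by exists A.
have [r rP] := choice each.
exists (\sum_pq `|r pq|) => A KA p q.
apply: le_trans (rP (p, q) A KA) _; apply: le_trans (ler_norm _) _.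
by rewrite (bigD1 (p, q))//= lerDl sumr_ge0.
Qed.

Lemma det_continuous n : continuous (fun A : 'M[R[i]]_n => \det A).
Proof.
rewrite /determinant.
apply: (@continuous_big _ _ +%R) => [|s _]; first exact: add_continuous.
have cp : continuous (fun A : 'M[R[i]]_n => \prod_i A i (s i)).
  apply: (@continuous_big R[i] 'I_n *%R 1 xpredT (@mul_continuous R[i]) _ _
    (fun i (A : 'M[R[i]]_n) => A i (s i))) => i _.
  exact: coord_continuous.
move=> A; exact: (continuous_comp (cp A) (@mulrl_continuous R[i] ((-1) ^+ s) _)).
Qed.

Lemma SL_closed n : closed (SL R n).
Proof.
rewrite (_ : SL R n = (fun A : 'M[R[i]]_n => \det A) @^-1` [set 1])//.
apply: closed_comp => [A _|]; first exact: det_continuous.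
exact/accessible_closed_set1/hausdorff_accessible/norm_hausdorff.
Qed.

Lemma discrete_SL_finite n (D : set 'M[R[i]]_n) (r : R) :
  discrete_subset (SL R n) D ->
  finite_set [set A | D A /\ forall p q, normc (A p q) <= r].
Proof.
move=> [DSL Dlim]; apply: contrapT => iD.
have [K cK rK] := @mx_bounded_compact n n r.
have [x Kx lx] := infinite_compact_limit_point cK iD
  (fun A (DA : D A /\ _) => rK A DA.2).
have lDx : limit_point D x by move=> U /lx[y [yx [Dy _] Uy]]; exists y.
apply: (Dlim x) => //; apply: (@SL_closed n).
by apply: closure_subset DSL _ _; exact: subset_limit_point.
Qed.

End Compactness.

(** * Shears along a column *)

Section Shear.
Variables (R : realType) (n : nat) (j1 j2 : 'I_n).
Hypothesis j12 : j1 != j2.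
Implicit Types A : 'M[R[i]]_n.

(** An elementary column operation whose coefficient depends on the matrix. *)
Definition shear (f : 'M[R[i]]_n -> R[i]) A : 'M[R[i]]_n :=
  A + f A *: (A *m delta_mx j1 j2).

Definition column_sum (g : 'I_n -> R[i] -> R[i]) A : R[i] :=
  \sum_p g p (A p j1).

Lemma mulmx_deltaE A p q : (A *m delta_mx j1 j2) p q = A p j1 *+ (q == j2).
Proof.
rewrite !mxE (bigD1 j1)//= big1 => [|k kj1]; last first.
  by rewrite mxE (negbTE kj1) mulr0.
by rewrite mxE eqxx /= addr0 mulr_natr.
Qed.

Lemma shearE f A p q : shear f A p q = A p q + f A * (A p j1 *+ (q == j2)).
Proof. by rewrite mxE [X in _ + X]mxE mulmx_deltaE. Qed.

Lemma shear_fixed_column f A p : shear f A p j1 = A p j1.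
Proof. by rewrite shearE (negbTE j12) mulr0n mulr0 addr0. Qed.

(** The matrix is triangular, lower or upper according to the order of [j1] and
    [j2]. *)
Lemma det_transvection (c : R[i]) : \det (1%:M + c *: delta_mx j1 j2) = 1.
Proof.
have diag i : (1%:M + c *: delta_mx j1 j2 : 'M[R[i]]_n) i i = 1.
  rewrite !mxE eqxx; case: eqP => [->|_]; last by rewrite mulr0 addr0.
  by rewrite (negbTE j12) mulr0 addr0.
have [lt12|] := ltnP j1 j2;
  last rewrite leq_eqVlt eq_sym => /orP[/eqP/val_inj e|lt21].
- rewrite -det_tr det_trig; first by rewrite big1// => i _; rewrite mxE.
  apply/is_trig_mxP => i j ij; rewrite !mxE.
  rewrite -val_eqE gtn_eqF// add0r; case: eqP => [jj|_]; last by rewrite mulr0.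
  case: eqP => [ii|_]; last by rewrite mulr0.
  by move: ij; rewrite ii jj ltnNge ltnW.
- by move: j12; rewrite e eqxx.
- rewrite det_trig; first by rewrite big1.
  apply/is_trig_mxP => i j ij; rewrite !mxE.
  rewrite -val_eqE ltn_eqF// add0r; case: eqP => [ii|_]; last by rewrite mulr0.
  case: eqP => [jj|_]; last by rewrite mulr0.
  by move: ij; rewrite ii jj ltnNge ltnW.
Qed.

Lemma det_shear f A : \det (shear f A) = \det A.
Proof.
rewrite (_ : shear f A = A *m (1%:M + f A *: delta_mx j1 j2)).
  by rewrite det_mulmx det_transvection mulr1.
by rewrite mulmxDr mulmx1 -scalemxAr.
Qed.

Lemma column_sum_shear f g A : column_sum g (shear f A) = column_sum g A.
Proof. by apply: eq_bigr => p _; rewrite shear_fixed_column. Qed.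

(** The coefficient depends on column [j1] only, which the shear preserves. *)
Lemma shearK g A :
  shear (\- column_sum g) (shear (column_sum g) A) = A.
Proof.
apply/matrixP => p q.
rewrite shearE shear_fixed_column shearE /= column_sum_shear.
by rewrite mulNr addrK.
Qed.

Lemma shear_differentiable (g : 'I_n -> R[i] -> R[i]) A :
  (forall p z, derivable (g p) z 1) ->
  differentiable (shear (column_sum g)) A.
Proof.
move=> dg.
have dcol p : differentiable (fun B : 'M[R[i]]_n => B p j1) A.
  exact: differentiable_coord.
have dsum : differentiable (column_sum g) A.
  rewrite (_ : column_sum g = \sum_p (fun B : 'M[R[i]]_n => g p (B p j1))).
    apply: differentiable_sum => p.
    apply: (@differentiable_comp _ _ _ _
      (fun B : 'M[R[i]]_n => B p j1) (g p)) => //.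
    exact/derivable1_diffP.
  by rewrite funeqE => B; rewrite fct_sumE.
(* Written this way, the map is a sum of scalar functions times constant
   matrices. *)
rewrite (_ : shear _ = id + \sum_p (fun B : 'M[R[i]]_n =>
    (column_sum g B * B p j1) *: (delta_mx p j2 : 'M[R[i]]_n))).
  apply: differentiableD => //; apply: differentiable_sum => p.
  by apply: differentiableZl; exact: differentiableM.
rewrite funeqE => B; apply/matrixP => p q.
rewrite shearE [RHS]mxE fct_sumE summxE (bigD1 p)//= big1.
  by rewrite !mxE eqxx /= addr0 mulr_natr mulrnAr.
by move=> k kp; rewrite !mxE [p == k]eq_sym (negbTE kp) mulr0.
Qed.

Lemma shear_automorphism (g : 'I_n -> R[i] -> R[i]) :
  (forall p z, derivable (g p) z 1) ->
  automorphism (SL R n) (shear (column_sum g)).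
Proof.
move=> dg.
have holo (h : 'I_n -> R[i] -> R[i]) : (forall p z, derivable (h p) z 1) ->
    holomorphic_on (SL R n) (shear (column_sum h)).
  move=> dh A _; exists (shear (column_sum h)).
  split; apply: (@filterE _ _ (nbhs_filter A)) => B; last by move=> _.
  exact: shear_differentiable.
pose g' p := - g p.
have dg' p z : derivable (g' p) z 1 by exact: derivableN.
have gN : \- column_sum g = column_sum g'.
  by rewrite funeqE => A; rewrite /column_sum /= -sumrN.
have gN' : \- column_sum g' = column_sum g.
  by rewrite funeqE => A; rewrite -gN /= opprK.
split; first by move=> A; rewrite /SL /= det_shear.
split; first exact: holo.
exists (shear (column_sum g')); split.
- by move=> A; rewrite /SL /= det_shear.
- exact: holo.
- by move=> A _; rewrite -gN shearK.
- by move=> A _; rewrite -gN' shearK.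
Qed.

End Shear.

(** * Tame sets from proper columns *)

Section Tame.
Variables (R : realType) (n : nat).
Implicit Types (A : 'M[R[i]]_n) (D T : set 'M[R[i]]_n).

(** On a closed discrete set, this says that taking the [j]-th column is a
    proper map to the space of column vectors. *)
Definition column_proper (j : 'I_n) T := forall r : R,
  finite_set [set A | T A /\ forall p, normc (A p j) <= r].

Lemma column_proper_countable j T : column_proper j T -> countable T.
Proof.
move=> Tj; pose F k := [set A | T A /\ forall p, normc (A p j) <= k%:R].
rewrite (_ : T = \bigcup_(k in setT) F k).
  by apply: bigcup_countable => // k _; apply: finite_set_countable; exact: Tj.
rewrite predeqE => A; split=> [TA|[k _ []//]].
exists (Num.truncn (\sum_p normc (A p j))).+1 => //; split=> // p.
apply: ltW; apply: le_lt_trans (truncnS_gt _).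
by rewrite (bigD1 p)//= lerDl sumr_ge0// => q _; exact: normc_ge0.
Qed.

Lemma det_column_neq0 A (j : 'I_n) : \det A = 1 -> exists p, A p j != 0.
Proof.
move=> dA; apply: contrapT => H.
have : \det A = 0.
  rewrite (expand_det_col A j) big1// => p _.
  suff -> : A p j = 0 by rewrite mul0r.
  by apply: contrapT => /eqP Ap; apply: H; exists p.
by move=> d0; move/eqP: dA; rewrite d0 eq_sym oner_eq0.
Qed.

Lemma max_column_entry A (j : 'I_n) :
  exists p, forall q, normc (A q j) <= normc (A p j).
Proof.
exists [arg max_(p > j) normc (A p j)]%O => q.
by case: arg_maxP => // p _ pmax; exact: pmax.
Qed.

(** The set is enumerated, and a shear with coefficient from [entire_growth]
    moves its [k]-th point out of the compact set [rho <= zeta (e k)] by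
    enlarging one entry of column [j2]. *)
Lemma tame_of_column_proper (j1 j2 : 'I_n) T : j1 != j2 ->
  infinite_set T -> discrete_subset (SL R n) T -> column_proper j1 T ->
  tame (SL R n) T.
Proof.
move=> j12 iT dT pT; split=> // rho zeta [_ _ crho] _.
have [TSL _] := dT.
have /card_esym/card_set_bijP := eq_card_nat (column_proper_countable pT) iT.
move=> [e [eT einj esurj]].
have Te k : T (e k) by exact: eT.
have detE k : \det (e k) = 1 by exact: TSL (Te k).
have [idx idxP] := choice (fun k => max_column_entry (e k) j1).
pose v k p : R[i] := e k p j1.
have a0 k : v k (idx k) != 0.
  have [p pP] := det_column_neq0 j1 (detE k).
  apply: contra pP => /eqP ak; apply/eqP/eq0_normc/eqP.
  rewrite eq_le normc_ge0 andbT; apply: le_trans (idxP k p) _.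
  by rewrite -/(v k (idx k)) ak normc0.
have ainf (r : R) : \forall k \near \oo, r <= normc (v k (idx k)).
  have fk : finite_set [set k | normc (v k (idx k)) <= r].
    apply: (@sub_finite_set _ _
      (e @^-1` [set A | T A /\ forall p, normc (A p j1) <= r])).
      by move=> k kr /=; split=> // p; exact: le_trans (idxP k p) kr.
    apply: finite_preimage; last exact: pT.
    by move=> k l _ _; apply: einj; rewrite in_setT.
  have /finite_seqP[X XE] := fk.
  exists (\sum_(i <- X) i).+1 => // k /= Xk.
  rewrite leNgt; apply/negP => /ltW kr.
  have kX : k \in X by have : [set` X] k by rewrite -XE.
  by move: Xk; rewrite (big_rem k)//= ltnNge leq_addr.
have bd k : exists r : R, forall A, SL R n A -> rho A <= zeta (e k) ->
    forall p q, normc (A p q) <= r.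
  have [r rP] := compact_mx_bounded (crho (zeta (e k))).
  by exists r => A SA Ar; exact: rP.
have [r rP] := choice bd.
(* The entry [(idx k, j2)] of the sheared matrix is [e k (idx k) j2] plus the
   value of the entire function times [v k (idx k)]; this [M] makes its modulus
   exceed the bound [r k] for the compact set. *)
pose M k := (`|r k| + 1 + normc (e k (idx k) j2)) / normc (v k (idx k)).
have [g [dg gM]] := entire_growth M a0 ainf.
exists (shear j1 j2 (column_sum j1 g)); split; first exact: shear_automorphism.
move=> _ /esurj[k _ <-]; rewrite leNgt; apply/negP => /ltW small.
have SLk : SL R n (shear j1 j2 (column_sum j1 g) (e k)).
  by rewrite /SL /= det_shear.
have := rP k _ SLk small (idx k) j2; apply/negP; rewrite -ltNge.
rewrite shearE eqxx mulr1n addrC; apply: lt_le_trans (normcD_ge _ _).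
rewrite normcM.
have := gM k; rewrite /M ler_pdivrMr ?normc_gt0//.
have := ler_norm (r k); rewrite /column_sum /v; lra.
Qed.

End Tame.

(** * The decomposition *)

Theorem corollary10p9 (R : realType) (n : nat) (hn : (2 <= n)%N)
    (D : set 'M[R[i]%C]_n) :
  infinite_set D -> discrete_subset (SL R n) D ->
  exists T : 'I_n -> set 'M[R[i]%C]_n,
    (forall i : 'I_n, tame (SL R n) (T i)) /\
    D = \bigcup_(i in [set: 'I_n]) T i.
Proof.
move=> iD dD; have [DSL Dlim] := dD.
pose E (j : 'I_n) := [set A | D A /\
  exists p, forall a b, normc (A a b) <= normc (A p j)].
have ED j : E j `<=` D by move=> A [].
have DE : D = \bigcup_(j in [set: 'I_n]) E j.
  rewrite predeqE => A; split=> [DA|[j _ /ED//]].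
  pose o := Ordinal (ltn_trans (ltn0Sn 0) hn).
  pose m := [arg max_(pq > (o, o)) normc (A pq.1 pq.2)]%O.
  exists m.2 => //; split=> //; exists m.1 => a b; rewrite /m.
  by case: arg_maxP => // pq _ /(_ (a, b)); apply.
have Eproper j : column_proper j (E j).
  move=> r; apply: sub_finite_set (discrete_SL_finite r dD) => A [[DA [p pP]] Ar].
  by split=> // a b; exact: le_trans (pP a b) (Ar p).
have [j0 iE0] : exists j, infinite_set (E j).
  apply: contrapT => H; apply: iD; rewrite DE; apply: bigcup_finite => // j _.
  by apply: contrapT => Ej; apply: H; exists j.
pose T j := if pselect (finite_set (E j)) then E j `|` E j0 else E j.
have TD j : T j `<=` D.
  by rewrite /T; case: pselect => ? A; [case=> /ED|move/ED].
exists T; split; last first.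
  rewrite predeqE => A; split=> [|[j _ /TD//]].
  rewrite {1}DE => -[j _ EA]; exists j => //; rewrite /T.
  by case: pselect => // ?; left.
move=> j.
have dT : discrete_subset (SL R n) (T j).
  split; first exact: subset_trans (@TD j) DSL.
  by move=> x /Dlim H lx; apply: H => U /lx[y [yx /TD Dy Uy]]; exists y.
have other (k : 'I_n) : exists l, k != l.
  pose o0 := Ordinal (ltn_trans (ltn0Sn 0) hn); pose o1 := Ordinal hn.
  by have [->|ko] := eqVneq k o0; [exists o1|exists o0].
have [[fE TE]|[iE TE]] : (finite_set (E j) /\ T j = E j `|` E j0) \/
    (infinite_set (E j) /\ T j = E j).
- by rewrite /T; case: pselect => ?; [left|right].
- rewrite TE in dT *.
  have [l jl] := other j0.
  apply: (tame_of_column_proper jl) => // [|r].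
    by rewrite finite_setU => -[].
  rewrite (_ : mkset _ = (E j `&` [set A | forall p, normc (A p j0) <= r]) `|`
    [set A | E j0 A /\ forall p, normc (A p j0) <= r]).
    rewrite finite_setU; split; last exact: Eproper.
    exact: finite_setIl.
  rewrite predeqE => A /=; split=> [[[]]|[[]|[]]];
    by [left|right|split; [left|]|split; [right|]].
- rewrite TE in dT *; have [l jl] := other j.
  exact: (tame_of_column_proper jl).
Qed.
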